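(* Let $P$, $Q$, $R$ be dMTSs over a common alphabet $A$, where $P$ and $Q$ have disjoint state sets, and let $p\in P$, $q\in Q$, $r\in R$. Then $p\vee q\sqsubseteq_{\mathrm{dMTS}} r$ if and only if $p\sqsubseteq_{\mathrm{dMTS}} r$ and $q\sqsubseteq_{\mathrm{dMTS}} r$.
   Context: A disjunctive Modal Transition System (dMTS) is a tuple $(P,A,\longrightarrow_P,\dashrightarrow_P)$ with $P$ a set of states, $A$ an alphabet not containing the silent action $\tau$, a must-transition relation $\longrightarrow_P\subseteq P\times A\times(2^P\setminus\{\emptyset\})$ and a may-transition relation $\dashrightarrow_P\subseteq P\times(A\cup\{\tau\})\times P$, satisfying syntactic consistency: $p\xrightarrow{a}P'$ (must) implies $p\stackrel{a}{\dashrightarrow}p'$ (may) for all $p'\in P'$. Weak may-transitions: $p\stackrel{\epsilon}{\Longrightarrow}p'$ iff $p(\stackrel{\tau}{\dashrightarrow})^*p'$; for $\alpha\in A\cup\{\tau\}$, $p\stackrel{\alpha}{\Longrightarrow}p'$ iff there is $p''$ with $p\stackrel{\epsilon}{\Longrightarrow}p''\stackrel{\alpha}{\dashrightarrow}p'$. $\hat\alpha=\epsilon$ if $\alpha=\tau$, else $\hat\alpha=\alpha$. For dMTSs $P,Q$ over $A$, $\mathcal R\subseteq P\times Q$ is an observational modal refinement relation if for all $(p,q)\in\mathcal R$: (i) $q\xrightarrow{a}Q'$ implies there is $P'$ with $p\xrightarrow{a}P'$ and for every $p'\in P'$ some $q'\in Q'$ with $(p',q')\in\mathcal R$; (ii)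 $p\stackrel{\alpha}{\dashrightarrow}p'$ implies there is $q'$ with $q\stackrel{\hat\alpha}{\Longrightarrow}q'$ and $(p',q')\in\mathcal R$. $p\sqsubseteq_{\mathrm{dMTS}}q$ iff some such relation contains $(p,q)$. dMTS-disjunction: for dMTSs $P,Q$ over $A$ with disjoint state sets, $P\vee Q$ has state set $\{p\vee q: p\in P,q\in Q\}\cup P\cup Q$, alphabet $A$, and the least must- and may-transition relations containing those of $P$ and $Q$ and satisfying: (Must) $p\vee q\xrightarrow{a}P'\cup Q'$ if $p\xrightarrow{a}_PP'$ and $q\xrightarrow{a}_QQ'$; (May1) $p\vee q\stackrel{\alpha}{\dashrightarrow}p'$ if $p\stackrel{\alpha}{\dashrightarrow}_Pp'$; (May2) $p\vee q\stackrel{\alpha}{\dashrightarrow}q'$ if $q\stackrel{\alpha}{\dashrightarrow}_Qq'$. *)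

(* Defs.v *)
From Stdlib Require Import Relation_Operators.
From mathcomp Require Import all_boot.
From mathcomp Require Import classical_sets.

Set Implicit Arguments.
Unset Strict Implicit.
Unset Printing Implicit Defensive.

Local Open Scope classical_set_scope.

(* Actions in A ∪ {τ} are elements of [option A]; [None] is τ, so that τ is not
   in A by construction. *)
Definition tau {A : Type} : option A := None.

Record dMTS (A : Type) : Type := DMTS {
  state :> Type;
  must : state -> A -> set state -> Prop;
  may : state -> option A -> state -> Prop;
  must_nonempty : forall p a P', must p a P' -> P' !=set0;
  must_may : forall p a P', must p a P' ->
    forall p', P' p' -> may p (Some a) p' }.

Arguments must {A d}.
Arguments may {A d}.

Inductive weak_label (A : Type) : Type :=
| Eps
| Act of option A.

Arguments Eps {A}.

Definition hat {A : Type} (alpha : option A) : weak_label A :=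
  match alpha with
  | None => Eps
  | Some _ => Act alpha
  end.

Definition weak_eps {A : Type} {P : dMTS A} : P -> P -> Prop :=
  clos_refl_trans P (fun p p' => may p tau p').

Definition weak_may {A : Type} {P : dMTS A}
    (p : P) (l : weak_label A) (p' : P) : Prop :=
  match l with
  | Eps => weak_eps p p'
  | Act alpha => exists p'' : P, weak_eps p p'' /\ may p'' alpha p'
  end.

Definition obs_modal_refinement {A : Type} (P Q : dMTS A)
    (rel : P -> Q -> Prop) : Prop :=
  forall (p : P) (q : Q), rel p q ->
    (forall (a : A) (Q' : set Q), must q a Q' ->
       exists P' : set P, must p a P' /\
         forall p', P' p' -> exists q', Q' q' /\ rel p' q') /\
    (forall (alpha : option A) (p' : P), may p alpha p' ->
       exists q' : Q, weak_may q (hat alpha) q' /\ rel p' q').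

Definition dMTS_refines {A : Type} (P Q : dMTS A) (p : P) (q : Q) : Prop :=
  exists rel : P -> Q -> Prop, obs_modal_refinement rel /\ rel p q.

Arguments dMTS_refines {A} P Q p q.

(* The states of P ∨ Q. State sets being types, the disjointness of P and Q is
   realised by the constructors, which tag the two components. *)
Inductive or_state (S T : Type) : Type :=
| Or of S & T
| OrL of S
| OrR of T.

Arguments Or {S T}.
Arguments OrL {S T}.
Arguments OrR {S T}.

Section Disjunction.
Context {A : Type} (P Q : dMTS A).

Local Notation PQ := (or_state P Q).

(* Being inductive, these are the least relations closed under the rules. *)
Inductive or_must : PQ -> A -> set PQ -> Prop :=
| or_must_left p a P' : must p a P' -> or_must (OrL p) a (OrL @` P')
| or_must_right q a Q' : must q a Q' -> or_must (OrR q) a (OrR @` Q')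
| or_must_Must p q a P' Q' : must p a P' -> must q a Q' ->
    or_must (Or p q) a ((OrL @` P') `|` (OrR @` Q')).

Inductive or_may : PQ -> option A -> PQ -> Prop :=
| or_may_left p alpha p' : may p alpha p' -> or_may (OrL p) alpha (OrL p')
| or_may_right q alpha q' : may q alpha q' -> or_may (OrR q) alpha (OrR q')
| or_may_May1 p q alpha p' :
    may p alpha p' -> or_may (Or p q) alpha (OrL p')
| or_may_May2 p q alpha q' :
    may q alpha q' -> or_may (Or p q) alpha (OrR q').

Lemma or_must_nonempty s a S' : or_must s a S' -> S' !=set0.
Proof.
case=> [p b P' m|q b Q' m|p q b P' Q' m _]; have [x Hx] := must_nonempty m.
- by exists (OrL x), x.
- by exists (OrR x), x.
- by exists (OrL x); left; exists x.
Qed.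

Lemma or_must_may s a S' : or_must s a S' ->
  forall s', S' s' -> or_may s (Some a) s'.
Proof.
case=> [p b P' m|q b Q' m|p q b P' Q' m n] s'.
- by case=> x Hx <-; constructor; exact: must_may m x Hx.
- by case=> x Hx <-; constructor; exact: must_may m x Hx.
- case=> [[x Hx <-]|[x Hx <-]]; constructor.
    exact: must_may m x Hx.
  exact: must_may n x Hx.
Qed.

Definition dMTS_or : dMTS A := DMTS or_must_nonempty or_must_may.

End Disjunction.

(* Main.v *)
Require Import Defs.
From mathcomp Require Import all_boot.
From mathcomp Require Import classical_sets.

Set Implicit Arguments.
Unset Strict Implicit.
Unset Printing Implicit Defensive.

Local Open Scope classical_set_scope.

Section Disjunction.
Context {A : Type} (P Q R : dMTS A).

(** Each direction converts witnessing relations. Given a refinement of the disjunction, [p]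
    inherits every pair of [OrL p] and of any [Or p q]: the latter provides the starting pair, the
    former suffices after one step, since every transition leads into a tagged component.
    Conversely, refinements of [P] and [Q] are glued in [or_rel]. *)

Definition left_rel (rel : dMTS_or P Q -> R -> Prop) (p : P) (r : R) : Prop :=
  rel (OrL p) r \/ exists q, rel (Or p q) r.

Definition right_rel (rel : dMTS_or P Q -> R -> Prop) (q : Q) (r : R) : Prop :=
  rel (OrR q) r \/ exists p, rel (Or p q) r.

(** A conjunction at [Or p q], because the rule (Must) needs a must-transition from both sides to
    answer one of [r]. *)
Definition or_rel (relP : P -> R -> Prop) (relQ : Q -> R -> Prop)
    (s : dMTS_or P Q) (r : R) : Prop :=
  match s with
  | Or p q => relP p r /\ relQ q r
  | OrL p => relP p r
  | OrR q => relQ q r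
  end.

(** A must-transition of [Or p q] projects to one of [p], and by (May1) every may-transition of [p]
    is one of [Or p q]. *)
Lemma left_rel_refinement rel :
  obs_modal_refinement rel -> obs_modal_refinement (left_rel rel).
Proof.
move=> relS p r [/relS|[q /relS]] [relM relW]; split.
- move=> a R' /relM [S' [mS S'R']]; inversion mS as [? ? P' mP| |]; subst.
  exists P'; split=> // p' P'p'.
  have [|r' [R'r' ?]] := S'R' (OrL p'); first by exists p'.
  by exists r'; split=> //; left.
- move=> alpha p' mP; have [r' [? ?]] := relW _ _ (or_may_left Q mP).
  by exists r'; split=> //; left.
(* Only (Must) applies, so [S'] is the union of the images of [P'] and [Q']; its left half alone
   answers for [p]. *)
- move=> a R' /relM [S' [mS S'R']]; inversion mS as [| |? ? ? P' Q' mP mQ]; subst.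
  exists P'; split=> // p' P'p'.
  have [|r' [R'r' ?]] := S'R' (OrL p'); first by left; exists p'.
  by exists r'; split=> //; left.
- move=> alpha p' mP; have [r' [? ?]] := relW _ _ (or_may_May1 q mP).
  by exists r'; split=> //; left.
Qed.

Lemma right_rel_refinement rel :
  obs_modal_refinement rel -> obs_modal_refinement (right_rel rel).
Proof.
move=> relS q r [/relS|[p /relS]] [relM relW]; split.
- move=> a R' /relM [S' [mS S'R']]; inversion mS as [|? ? Q' mQ|]; subst.
  exists Q'; split=> // q' Q'q'.
  have [|r' [R'r' ?]] := S'R' (OrR q'); first by exists q'.
  by exists r'; split=> //; left.
- move=> alpha q' mQ; have [r' [? ?]] := relW _ _ (or_may_right P mQ).
  by exists r'; split=> //; left.
- move=> a R' /relM [S' [mS S'R']]; inversion mS as [| |? ? ? P' Q' mP mQ]; subst.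
  exists Q'; split=> // q' Q'q'.
  have [|r' [R'r' ?]] := S'R' (OrR q'); first by right; exists q'.
  by exists r'; split=> //; left.
- move=> alpha q' mQ; have [r' [? ?]] := relW _ _ (or_may_May2 p mQ).
  by exists r'; split=> //; left.
Qed.

Lemma or_rel_refinement relP relQ :
  obs_modal_refinement relP -> obs_modal_refinement relQ ->
  obs_modal_refinement (or_rel relP relQ).
Proof.
move=> refP refQ [p q|p|q] r /=.
- move=> [/refP[mP wP] /refQ[mQ wQ]]; split.
    move=> a R' mR; have [P' [pP' P'R']] := mP _ _ mR.
    have [Q' [qQ' Q'R']] := mQ _ _ mR.
    exists ((OrL @` P') `|` (OrR @` Q')); split; first exact: or_must_Must.
    (* On tagged targets [or_rel] computes to [relP] or [relQ], so the matches found on each side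
       serve unchanged. *)
    by move=> _ [[x /P'R' ? <-]|[x /Q'R' ? <-]].
  (* The move stems from (May1) or (May2), so one component alone matches it. *)
  move=> alpha s' ms; inversion ms; subst; first exact: wP.
  exact: wQ.
- move=> /refP[mP wP]; split.
    move=> a R' mR; have [P' [pP' P'R']] := mP _ _ mR.
    exists (OrL @` P'); split; first exact: or_must_left.
    by move=> _ [x /P'R' ? <-].
  by move=> alpha s' ms; inversion ms; subst; exact: wP.
- move=> /refQ[mQ wQ]; split.
    move=> a R' mR; have [Q' [qQ' Q'R']] := mQ _ _ mR.
    exists (OrR @` Q'); split; first exact: or_must_right.
    by move=> _ [x /Q'R' ? <-].
  by move=> alpha s' ms; inversion ms; subst; exact: wQ.
Qed.

End Disjunction.

Theorem theorem3p10 (A : Type) (P Q R : dMTS A) (p : P) (q : Q) (r : R) :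
  dMTS_refines (dMTS_or P Q) R (Or p q) r <->
  dMTS_refines P R p r /\ dMTS_refines Q R q r.
Proof.
split=> [[rel [ref relpq]]|[[relP [refP pr]] [relQ [refQ qr]]]].
- split.
    exists (left_rel rel); split; first exact: left_rel_refinement.
    by right; exists q.
  exists (right_rel rel); split; first exact: right_rel_refinement.
  by right; exists p.
- by exists (or_rel relP relQ); split; first exact: or_rel_refinement.
Qed.
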